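(* Let $\{(x^k,z^k,y^k,\pi^k,\xi^k,\eta^k,\zeta^k,\varphi_k)\}_{k\ge 0}$ be generated by the Master Algorithm described in the context, applied to $(P)$: $\min\{f(x): Ax\ge b,\ Cx=d\}$, under the standing assumptions and requirements listed in the context, and let $\alpha_k:=1/\varphi_k$, $\overline\pi^k:=\alpha_k\pi^k$, $\overline\omega^k:=\alpha_k(\eta^k-\zeta^k)$. If $(P)$ is infeasible, then given $\epsilon>0$ there exists $\hat k$ such that $$\|A^T\overline\pi^{\hat k}+C^T\overline\omega^{\hat k}\|\le\epsilon,\qquad b^T\overline\pi^{\hat k}+d^T\overline\omega^{\hat k}>0,$$ and $$\mathbf 1^T[z^{\hat k};y^{\hat k}]\le \mathbf 1^T[\hat z;\hat y]+\epsilon,$$ where $\overline\pi^{\hat k}\ge0$ and $(\hat z,\hat y)$ is the $(z,y)$-part of a solution of $$(\tilde P_0)\qquad\min_{x,z,y}\ \mathbf 1^T[z;y]\ \text{ s.t. } Ax+z\ge b,\ Cx+y\ge d,\ -Cx+y\ge-d,\ z\ge0 .$$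
   Context: Problem. $n\ge p\ge 0$, $m\ge0$, $m+p>0$; $H\in\mathbb R^{n\times n}$ symmetric positive semidefinite, $c\in\mathbb R^n$, $A\in\mathbb R^{m\times n}$, $b\in\mathbb R^m$, $C\in\mathbb R^{p\times n}$, $d\in\mathbb R^p$; $f(x)=\frac12x^THx+c^Tx$. Inequalities between vectors are componentwise; $\mathbf 1$ is the all-ones vector; $\|\cdot\|$ is an arbitrary norm; for a vector $v$, the capital letter $V$ denotes $\mathrm{diag}(v)$; $[u;v]$ is vertical concatenation. $(P)$: minimize $f(x)$ subject to $Ax\ge b$, $Cx=d$. Standing assumptions (feasibility of $(P)$ is not assumed). Vectors $b'\le b$, $d'_-\le d$, $d'_+\ge d$ are fixed such that the relaxed problem $(P')$: minimize $f(x)$ s.t. $Ax\ge b'$, $Cx\ge d'_-$, $Cx\le d'_+$, is feasible. It is assumed that: $(P')$ has a nonempty bounded optimal solution set; $(P')$ has a bounded feasible set; $C$ has full row rank and $[H;A;C]$ has full column rank. Augmented problem. For $\varphi>0$, $(\tilde P_\varphi)$: minimize $\tilde f_\varphi(x,z,y):=f(x)+\varphi\mathbf 1^T[z;y]$ over $(x,z,y)\in\mathbb R^n\times\mathbb R^m\times\mathbb R^p$ subject to $Ax+z\ge b$, $z\ge0$, $Cx+y\ge d$, $-Cx+y\ge -d$. This is an inequality-constrained CQP in $(x,z,y)$; multipliers of the four groups of constraints are denoted $\pi,\xi,\eta,\zeta$ respectively. Base iteration. A procedure (possibly with internal state) which, applied repeatedly to an inequality-constrained CQP ''minimize $q(u)=\frac12u^TQu+g^Tu$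 s.t. $Mu\ge h$'' ($Q$ symmetric positive semidefinite), produces a primal sequence $\{u^\ell\}_{\ell\ge0}$ with an associated dual sequence $\{\lambda^\ell\}$, $\lambda^\ell\ge0$, such that: (BI1) at least one of the following holds: (i) $u^{\ell+1}$ is feasible whenever $u^\ell$ is feasible; (ii) $u^{\ell+1}$ is strictly feasible ($Mu^{\ell+1}>h$) whenever $u^\ell$ is strictly feasible; (BI2) for every $\ell_0\ge0$ there is $\ell>\ell_0$ with $q(u^\ell)\le q(u^{\ell_0})$; (BI3) with $\hat K:=\{k>0: q(u^k)\le q(u^\ell)\ \forall \ell<k\}$ (an infinite set), if $\{u^k\}_{k\in\hat K}$ is bounded then $\max\{\|\mathrm{diag}(Mu^k-h)\lambda^k\|,\|Qu^k+g-M^T\lambda^k\|\}\to0$ as $k\to\infty$, $k\in\hat K$. Master Algorithm. Initialization: $(x^0,z^0,y^0)$ strictly feasible for the constraints of $(\tilde P_\varphi)$ (merely feasible is allowed if (BI1)(i) holds), $(\pi^0,\xi^0,\eta^0,\zeta^0)\ge0$, $\varphi_0>0$. Iteration $k=0,1,2,\dots$: the penalty-parameter update, from $\varphi_k$ and the current primal and dual iterates, returns $\varphi_{k+1}\ge\varphi_k$; then the base iteration is applied to $(\tilde P_{\varphi_{k+1}})$ from $(x^k,z^k,y^k)$, repeatedly, until it returns a point whose $\tilde f_{\varphi_{k+1}}$-value is at most $\tilde f_{\varphi_{k+1}}(x^k,z^k,y^k)$; this point is $(x^{k+1},z^{k+1},y^{k+1})$ and its associated dual vector is $(\pi^{k+1},\xi^{k+1},\eta^{k+1},\zeta^{k+1})\ge0$.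 As long as the penalty parameter stays constant, the successive base iterates form a single run of the base iteration on that augmented problem. No stopping criterion is used, so the sequences are infinite; in particular $\tilde f_{\varphi_k}(x^k,z^k,y^k)\le\tilde f_{\varphi_k}(x^{k-1},z^{k-1},y^{k-1})$ for all $k\ge1$. Slacks: $s^k=Ax^k+z^k-b$, $t_+^k=Cx^k+y^k-d$, $t_-^k=-Cx^k+y^k+d$. Requirements on the penalty-parameter update. Let $G_1^k:=(S^k\pi^k,Z^k\xi^k,T_+^k\eta^k,T_-^k\zeta^k)$, $G_2^k:=(Hx^k+c-A^T\pi^k-C^T(\eta^k-\zeta^k),\ \pi^k+\xi^k-\varphi_k\mathbf 1,\ \eta^k+\zeta^k-\varphi_k\mathbf 1)$, $G_3^k:=(Hx^k+c-A^T\pi^k-C^T(\eta^k-\zeta^k))^Tx^k$. (PU1) $\{\varphi_k\}$ is positive, nondecreasing, and either eventually constant or grows without bound. (PU2) If $\{(z^k,y^k)\}$ is unbounded then $\varphi_k\to\infty$. (PU3) If $\varphi_k$ is eventually constant, equal to $\hat\varphi$, and $\|G_1^k\|,\|G_2^k\|,|G_3^k|\to0$, then $\hat\varphi>\liminf_k\|[\pi^k;\eta^k-\zeta^k]\|_\infty$. (PU4) If $\varphi_k\to\infty$ and $\{(z^k,y^k)\}$ is bounded, then there is an infinite index set $K$ such that $G_1^k$, $G_2^k$, $G_3^k$ and $\varphi_k/\max\{1,\|[\pi^k;\eta^k-\zeta^k]\|\}$ are bounded on $K$. *)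

(* Defs.v *)
From HB Require Import structures.
From mathcomp Require Import all_boot all_order all_algebra.
From mathcomp Require Import all_classical all_reals all_analysis.

Set Implicit Arguments.
Unset Strict Implicit.
Unset Printing Implicit Defensive.

Import Order.TTheory GRing.Theory Num.Theory.
Import numFieldNormedType.Exports.

Local Open Scope classical_set_scope.
Local Open Scope ring_scope.

Section Vectors.
Variable R : realType.

Definition vle k (u v : 'cV[R]_k) : Prop := forall i, u i 0 <= v i 0.
Definition vlt k (u v : 'cV[R]_k) : Prop := forall i, u i 0 < v i 0.

Definition dotv k (u v : 'cV[R]_k) : R := (u^T *m v) 0 0.

Definition diagv k (v : 'cV[R]_k) : 'M[R]_k := diag_mx v^T.

Definition ones k : 'cV[R]_k := const_mx 1.

Record is_norm k (nu : 'cV[R]_k -> R) : Prop := IsNorm {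
  norm_triangle : forall u v, nu (u + v) <= nu u + nu v;
  norm_scale : forall (a : R) u, nu (a *: u) = `|a| * nu u;
  norm_definite : forall u, nu u = 0 -> u = 0 }.

Definition sym_psd k (Q : 'M[R]_k) : Prop :=
  Q^T = Q /\ forall u : 'cV[R]_k, 0 <= dotv u (Q *m u).

Definition argmin T (S : set T) (q : T -> R) : set T :=
  [set u | S u /\ forall v, S v -> q u <= q v].

End Vectors.

(* Inequality-constrained quadratic programs: min 1/2 u^T Q u + g^T u subject
   to M u >= h. *)
Record cqp (R : realType) (N M : nat) := Cqp {
  cqp_Q : 'M[R]_N;
  cqp_g : 'cV[R]_N;
  cqp_M : 'M[R]_(M, N);
  cqp_h : 'cV[R]_M }.

Section Cqp.
Variables (R : realType) (N M : nat) (q : cqp R N M).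

Definition cqp_convex : Prop := sym_psd (cqp_Q q).
Definition cqp_obj (u : 'cV[R]_N) : R :=
  2^-1 * dotv u (cqp_Q q *m u) + dotv (cqp_g q) u.
Definition cqp_feasible (u : 'cV[R]_N) : Prop := vle (cqp_h q) (cqp_M q *m u).
Definition cqp_strict (u : 'cV[R]_N) : Prop := vlt (cqp_h q) (cqp_M q *m u).

Definition cqp_compl (u : 'cV[R]_N) (lam : 'cV[R]_M) : 'cV[R]_M :=
  diagv (cqp_M q *m u - cqp_h q) *m lam.
Definition cqp_grad (u : 'cV[R]_N) (lam : 'cV[R]_M) : 'cV[R]_N :=
  cqp_Q q *m u + cqp_g q - (cqp_M q)^T *m lam.

End Cqp.

(* A configuration is (internal state, primal point, dual vector).  A base
   iteration is a step map on configurations, for quadratic programs of every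
   size; [bi_init] tells which configurations it may be started from, so that
   it constrains the initial internal state. *)
Record base_iteration (R : realType) := BaseIteration {
  bi_state : Type;
  bi_init : forall N M, cqp R N M -> bi_state * 'cV[R]_N * 'cV[R]_M -> Prop;
  bi_step : forall N M, cqp R N M ->
    bi_state * 'cV[R]_N * 'cV[R]_M -> bi_state * 'cV[R]_N * 'cV[R]_M }.

Section BaseIteration.
Variables (R : realType) (norm : forall k, 'cV[R]_k -> R).
Variable B : base_iteration R.

Definition bi_run N M (q : cqp R N M)
    (r : nat -> bi_state B * 'cV[R]_N * 'cV[R]_M) : Prop :=
  [/\ bi_init q (r 0), vle 0 (r 0).2
    & forall l, r l.+1 = bi_step q (r l)].

Definition BI1_feasible : Prop :=
  forall N M (q : cqp R N M) r, cqp_convex q -> bi_run q r ->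
  forall l, cqp_feasible q (r l).1.2 -> cqp_feasible q (r l.+1).1.2.

Definition BI1_strict : Prop :=
  forall N M (q : cqp R N M) r, cqp_convex q -> bi_run q r ->
  forall l, cqp_strict q (r l).1.2 -> cqp_strict q (r l.+1).1.2.

Definition BI1 : Prop := BI1_feasible \/ BI1_strict.

Definition BI2 : Prop :=
  forall N M (q : cqp R N M) r, cqp_convex q -> bi_run q r ->
  forall l0, exists2 l, (l0 < l)%N &
    cqp_obj q (r l).1.2 <= cqp_obj q (r l0).1.2.

Definition record_lows N M (q : cqp R N M) (u : nat -> 'cV[R]_N) : set nat :=
  [set k | (0 < k)%N /\
           forall l, (l < k)%N -> cqp_obj q (u k) <= cqp_obj q (u l)].

Definition BI3 : Prop :=
  forall N M (q : cqp R N M) r, cqp_convex q -> bi_run q r ->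
  let u l := (r l).1.2 in
  let lam l := (r l).2 in
  let K := record_lows q u in
  [bounded u k | k in K] ->
  Num.max (norm (cqp_compl q (u k) (lam k)))
          (norm (cqp_grad q (u k) (lam k))) @[k --> within K \oo] --> (0 : R).

Definition BI_dual_ge0 : Prop :=
  forall N M (q : cqp R N M) r, cqp_convex q -> bi_run q r ->
  forall l, vle 0 (r l).2.

Definition is_base_iteration : Prop := [/\ BI_dual_ge0, BI1, BI2 & BI3].

End BaseIteration.

(* Data of (P): min 1/2 x^T H x + c^T x subject to A x >= b, C x = d. *)
Record qp (R : realType) (n m p : nat) := Qp {
  qpH : 'M[R]_n;
  qpc : 'cV[R]_n;
  qpA : 'M[R]_(m, n);
  qpb : 'cV[R]_m;
  qpC : 'M[R]_(p, n);
  qpd : 'cV[R]_p }.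

Record iterate (R : realType) (n m p : nat) := Iterate {
  it_x : 'cV[R]_n;
  it_z : 'cV[R]_m;
  it_y : 'cV[R]_p;
  it_pi : 'cV[R]_m;
  it_xi : 'cV[R]_m;
  it_eta : 'cV[R]_p;
  it_zeta : 'cV[R]_p }.

Section Problem.
Variables (R : realType) (n m p : nat) (P : qp R n m p).

Local Notation H := (qpH P).
Local Notation c := (qpc P).
Local Notation A := (qpA P).
Local Notation b := (qpb P).
Local Notation C := (qpC P).
Local Notation d := (qpd P).

Definition qp_obj (x : 'cV[R]_n) : R := 2^-1 * dotv x (H *m x) + dotv c x.

Definition qp_feasible : set 'cV[R]_n :=
  [set x | vle b (A *m x) /\ C *m x = d].

Definition relaxed_feasible (b' : 'cV[R]_m) (dminus dplus : 'cV[R]_p) :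
    set 'cV[R]_n :=
  [set x | [/\ vle b' (A *m x), vle dminus (C *m x) & vle (C *m x) dplus]].

Definition standing_assumptions (b' : 'cV[R]_m) (dminus dplus : 'cV[R]_p) :
    Prop :=
  let S := relaxed_feasible b' dminus dplus in
  [/\ [/\ vle b' b, vle dminus d & vle d dplus], S !=set0,
      argmin S qp_obj !=set0 /\ bounded_set (argmin S qp_obj),
      bounded_set S
    & row_free C /\ row_full (col_mx H (col_mx A C))].

Definition aug_feasible : set ('cV[R]_n * 'cV[R]_m * 'cV[R]_p) :=
  [set w | let: (x, z, y) := w in
     [/\ vle b (A *m x + z), vle 0 z, vle d (C *m x + y)
       & vle (- d) (- C *m x + y)]].

Definition infeasibility (z : 'cV[R]_m) (y : 'cV[R]_p) : R :=
  dotv (ones R (m + p)) (col_mx z y).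

(* Solution set of the phase-one linear program (P~_0). *)
Definition P0_solutions : set ('cV[R]_n * 'cV[R]_m * 'cV[R]_p) :=
  argmin aug_feasible (fun w => infeasibility w.1.2 w.2).

(* (P~_phi) in the variable [x; z; y], the constraint groups being ordered as
   their multipliers pi, xi, eta, zeta. *)
Definition aug (phi : R) : cqp R (n + (m + p)) (m + (m + (p + p))) := {|
  cqp_Q := block_mx H 0 0 0;
  cqp_g := col_mx c (phi *: ones R (m + p));
  cqp_M := col_mx (row_mx A (row_mx 1%:M 0))
          (col_mx (row_mx 0 (row_mx 1%:M 0))
          (col_mx (row_mx C (row_mx 0 1%:M))
                  (row_mx (- C) (row_mx 0 1%:M))));
  cqp_h := col_mx b (col_mx 0 (col_mx d (- d))) |}.

Definition it_primal (w : iterate R n m p) : 'cV[R]_(n + (m + p)) :=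
  col_mx (it_x w) (col_mx (it_z w) (it_y w)).
Definition it_dual (w : iterate R n m p) : 'cV[R]_(m + (m + (p + p))) :=
  col_mx (it_pi w) (col_mx (it_xi w) (col_mx (it_eta w) (it_zeta w))).

Lemma vle_col_mx k1 k2 (u1 v1 : 'cV[R]_k1) (u2 v2 : 'cV[R]_k2) :
  vle (col_mx u1 u2) (col_mx v1 v2) <-> vle u1 v1 /\ vle u2 v2.
Proof.
split=> [h|[h1 h2] i].
  by split=> i; [have := h (lshift _ i)|have := h (rshift _ i)];
     rewrite ?col_mxEu ?col_mxEd.
by rewrite !mxE; case: splitP => j _.
Qed.

Lemma aug_feasibleE phi x z y :
  cqp_feasible (aug phi) (col_mx x (col_mx z y)) <-> aug_feasible (x, z, y).
Proof.
rewrite /cqp_feasible /= !mul_col_mx !mul_row_col !mul1mx !mul0mx.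
rewrite !(addr0, add0r).
by split=> [/vle_col_mx[? /vle_col_mx[? /vle_col_mx[? ?]]]|[? ? ? ?]];
   [split|do !(apply/vle_col_mx; split)].
Qed.

Lemma aug_objE phi x z y :
  cqp_obj (aug phi) (col_mx x (col_mx z y)) =
  qp_obj x + phi * infeasibility z y.
Proof.
rewrite /cqp_obj /qp_obj /infeasibility /dotv /= mul_block_col !mul0mx !addr0.
rewrite !tr_col_mx !mul_row_col mulmx0 addr0.
rewrite linearZ /= -scalemxAl [X in _ + X]mxE addrA.
by rewrite [X in _ + _ + X]mxE.
Qed.

Definition slack_s (w : iterate R n m p) := A *m it_x w + it_z w - b.
Definition slack_tp (w : iterate R n m p) := C *m it_x w + it_y w - d.
Definition slack_tm (w : iterate R n m p) := - C *m it_x w + it_y w + d.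

Definition dual_resid (w : iterate R n m p) : 'cV[R]_n :=
  H *m it_x w + c - A^T *m it_pi w - C^T *m (it_eta w - it_zeta w).

Definition G1 (w : iterate R n m p) : 'cV[R]_(m + (m + (p + p))) :=
  col_mx (diagv (slack_s w) *m it_pi w)
  (col_mx (diagv (it_z w) *m it_xi w)
  (col_mx (diagv (slack_tp w) *m it_eta w)
          (diagv (slack_tm w) *m it_zeta w))).

Definition G2 (phi : R) (w : iterate R n m p) : 'cV[R]_(n + (m + p)) :=
  col_mx (dual_resid w)
  (col_mx (it_pi w + it_xi w - phi *: ones R m)
          (it_eta w + it_zeta w - phi *: ones R p)).

Definition G3 (w : iterate R n m p) : R := dotv (dual_resid w) (it_x w).

Definition eq_dual (w : iterate R n m p) : 'cV[R]_(m + p) :=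
  col_mx (it_pi w) (it_eta w - it_zeta w).

Section Master.
Variable norm : forall k, 'cV[R]_k -> R.
Variable B : base_iteration R.
Variable upd : R -> iterate R n m p -> R.
Variables (w : nat -> iterate R n m p) (phi : nat -> R).

(* Iteration k, with the base iteration in internal states s0 before and s1
   after.  The current run is continued if the penalty parameter is unchanged;
   otherwise, and at k = 0, a new run is started from the current iterate.  The
   next iterate is the first base iterate, after j >= 1 steps, whose objective
   value does not exceed the current one. *)
Definition master_step (k : nat) (s0 s1 : bi_state B) : Prop :=
  let q := aug (phi k.+1) in
  exists (s : bi_state B) (j : nat),
    let r i := iter i (bi_step q) (s, it_primal (w k), it_dual (w k)) in
    [/\ if (0 < k)%N && (phi k.+1 == phi k) then s = s0 else bi_init q (r 0),
        forall i, (0 < i < j)%N ->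
          cqp_obj q (it_primal (w k)) < cqp_obj q (r i).1.2,
        (0 < j)%N,
        cqp_obj q (r j).1.2 <= cqp_obj q (it_primal (w k))
      & r j = (s1, it_primal (w k.+1), it_dual (w k.+1))].

(* The constraints of (P~_phi) do not depend on phi. *)
Definition master_generated : Prop :=
  [/\ cqp_strict (aug (phi 0)) (it_primal (w 0)) \/
        (BI1_feasible B /\ cqp_feasible (aug (phi 0)) (it_primal (w 0))),
      vle 0 (it_dual (w 0)),
      0 < phi 0,
      forall k, phi k.+1 = upd (phi k) (w k) /\ phi k <= phi k.+1
    & exists s : nat -> bi_state B, forall k, master_step k (s k) (s k.+1)].

Definition bounded_zy : Prop :=
  [bounded col_mx (it_z (w k)) (it_y (w k)) | k in [set: nat]].

Definition PU1 : Prop :=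
  [/\ forall k, 0 < phi k, nondecreasing_seq phi
    & (exists phihat, \forall k \near \oo, phi k = phihat) \/
      phi k @[k --> \oo] --> +oo].

Definition PU2 : Prop := ~ bounded_zy -> phi k @[k --> \oo] --> +oo.

Definition PU3 : Prop :=
  forall phihat, (\forall k \near \oo, phi k = phihat) ->
  norm (G1 (w k)) @[k --> \oo] --> (0 : R) ->
  norm (G2 (phi k) (w k)) @[k --> \oo] --> (0 : R) ->
  `|G3 (w k)| @[k --> \oo] --> (0 : R) ->
  (limn_einf (fun k => (mx_norm (eq_dual (w k)))%:E) < phihat%:E)%E.

Definition PU4 : Prop :=
  phi k @[k --> \oo] --> +oo -> bounded_zy ->
  exists K : set nat,
    [/\ infinite_set K,
        [bounded G1 (w k) | k in K],
        [bounded G2 (phi k) (w k) | k in K],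
        [bounded G3 (w k) | k in K]
      & [bounded phi k / Num.max 1 (norm (eq_dual (w k))) | k in K]].

End Master.
End Problem.

(* Main.v *)
Require Import Defs.
From HB Require Import structures.
From mathcomp Require Import all_boot all_order all_algebra.
From mathcomp Require Import all_classical all_reals all_analysis.
From mathcomp Require Import ring lra.
Import Order.TTheory GRing.Theory Num.Theory.
Import numFieldNormedType.Exports.
Local Open Scope classical_set_scope.
Local Open Scope ring_scope.

Set Implicit Arguments.
Unset Strict Implicit.
Unset Printing Implicit Defensive.

(** Write theta for the infeasibility 1^T [z; y], and mu for its minimum over
the constraints of the augmented problem.

Geometry. Eliminating (z, y), theta becomes the total violation of A x >= b, C
x = d. As the relaxed feasible set is nonempty and bounded, the homogeneous
system A u >= 0, C u = 0 has only the zero solution, so its violation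
dominates a positive multiple of |u| ([sublinear_coercive]). Hence x is
bounded in terms of theta on the augmented feasible set ([aug_x_bound]), the
minimum mu is attained ([P0_solution_exists]), and mu > 0 because (P) is
infeasible ([infeasibility_gt0]).

The penalty tends to infinity ([penalty_unbounded]). Otherwise the iterates
are eventually the record lows of a single run of the base iteration
([tail_run]), they are bounded, and the optimality residuals tend to 0. The
update rule then provides infinitely many iterates whose pi and eta - zeta are
smaller in sup norm than the penalty by a fixed margin, so that xi, eta and
zeta are bounded away from 0 and complementarity drives theta to 0
([infeasibility_small]), against theta >= mu.

Limit behaviour. f is bounded below by -c (1 + theta) for some c, so once phi
exceeds c the descent property keeps theta bounded ([infeasibility_bounded]);
so x is bounded, and [PU4] gives an infinite set of indices on which the
unscaled residuals are bounded. On that set the multipliers divided by phi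
satisfy the optimality conditions of the phase-one linear program up to
O(1/phi): the residual of the stationarity equation is O(1/phi), and by
[lagrangian_identity] the scaled dual objective is at least theta - O(1/phi)
and at most mu + O(1/phi) ([certificate_estimate]). Since theta >= mu > 0, any
index of the set with phi large enough satisfies all conclusions at once. *)

(** * Column vectors, sublinear functions and norms *)

Section ColumnVectors.
Variable R : realType.

Lemma dotvE k (u v : 'cV[R]_k) : dotv u v = \sum_i u i 0 * v i 0.
Proof. by rewrite /dotv mxE; apply: eq_bigr => i _; rewrite mxE. Qed.

Lemma dotvDl k (u1 u2 v : 'cV[R]_k) : dotv (u1 + u2) v = dotv u1 v + dotv u2 v.
Proof. by rewrite /dotv linearD /= mulmxDl mxE. Qed.

Lemma dotvDr k (u v1 v2 : 'cV[R]_k) : dotv u (v1 + v2) = dotv u v1 + dotv u v2.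
Proof. by rewrite /dotv mulmxDr mxE. Qed.

Lemma dotvNl k (u v : 'cV[R]_k) : dotv (- u) v = - dotv u v.
Proof. by rewrite /dotv linearN /= mulNmx mxE. Qed.

Lemma dotvNr k (u v : 'cV[R]_k) : dotv u (- v) = - dotv u v.
Proof. by rewrite /dotv mulmxN mxE. Qed.

Lemma dotvZr k a (u v : 'cV[R]_k) : dotv u (a *: v) = a * dotv u v.
Proof. by rewrite /dotv -scalemxAr mxE. Qed.

Lemma dotvC k (u v : 'cV[R]_k) : dotv u v = dotv v u.
Proof. by rewrite !dotvE; apply: eq_bigr => i _; rewrite mulrC. Qed.

Lemma dotv_mulmxl k l (M : 'M[R]_(k, l)) u v :
  dotv (M *m u) v = dotv u (M^T *m v).
Proof. by rewrite /dotv trmx_mul mulmxA. Qed.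

Lemma dotv_col_mx k l (u1 v1 : 'cV[R]_k) (u2 v2 : 'cV[R]_l) :
  dotv (col_mx u1 u2) (col_mx v1 v2) = dotv u1 v1 + dotv u2 v2.
Proof. by rewrite /dotv tr_col_mx mul_row_col mxE. Qed.

Lemma dotv_ge0 k (u v : 'cV[R]_k) : vle 0 u -> vle 0 v -> 0 <= dotv u v.
Proof.
move=> u0 v0; rewrite dotvE; apply: sumr_ge0 => i _.
by have := u0 i; have := v0 i; rewrite !mxE => *; apply: mulr_ge0.
Qed.

Lemma normv_leP k (u : 'cV[R]_k) e : 0 <= e ->
  (`|u| <= e) <-> (forall i, `|u i 0| <= e).
Proof.
move=> e0; rewrite [X in X <= _]/Num.Def.normr /= mx_normrE; split.
  by move=> /bigmax_leP[_ h] i; have := h (i, 0) isT.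
by move=> h; apply/bigmax_leP; split => // -[i j] _ /=; rewrite (ord1 j).
Qed.

Lemma entry_le_normv k (u : 'cV[R]_k) i : `|u i 0| <= `|u|.
Proof. by have /normv_leP : `|u| <= `|u| by []; apply. Qed.

Lemma norm_tr_le k (v : 'rV[R]_k) : `|v^T| <= `|v|.
Proof.
apply/normv_leP => // i; rewrite mxE.
rewrite [leRHS]/Num.Def.normr /= mx_normrE.
exact: (le_bigmax _ (fun ij : 'I_1 * 'I_k => `|v ij.1 ij.2|) (0, i)).
Qed.

Lemma norm_tr k (v : 'rV[R]_k) : `|v^T| = `|v|.
Proof.
apply/eqP; rewrite eq_le norm_tr_le /=.
rewrite {1}/Num.Def.normr /= mx_normrE; apply/bigmax_leP; split => // -[i j] _ /=.
by rewrite (ord1 i); have := entry_le_normv v^T j; rewrite mxE.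
Qed.

Lemma normr_dotv_le k (u v : 'cV[R]_k) : `|dotv u v| <= k%:R * (`|u| * `|v|).
Proof.
rewrite dotvE; apply: le_trans (ler_norm_sum _ _ _) _.
have -> : k%:R * (`|u| * `|v|) = \sum_(i < k) (`|u| * `|v|).
  by rewrite sumr_const card_ord mulr_natl.
by apply: ler_sum => i _; rewrite normrM ler_pM ?entry_le_normv.
Qed.

(** Serves both the unit sphere (a = r = 1) and closed balls (a = 0).
Compactness is used on row vectors, hence the detour through transposition. *)
Lemma lipschitz_argmin_shell k (h : 'cV[R]_k -> R) L a r :
  (forall u v, h u - h v <= L * `|u - v|) ->
  (exists u : 'cV[R]_k, a <= `|u| <= r) ->
  exists2 c, a <= `|c| <= r & forall u, a <= `|u| <= r -> h c <= h u.
Proof.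
move=> hL [u0 u0P].
pose S := [set v : 'rV[R]_k | a <= `|v| <= r].
have Scl : closed S.
  rewrite (_ : S = (fun v : 'rV[R]_k => `|v|) @^-1` `[a, r]%classic); last first.
    by apply/seteqP; split=> v; rewrite /S /= in_itv.
  apply: closed_comp; last exact: itv_closed.
  by move=> v _; exact: norm_continuous.
have Sb : bounded_set S.
  by exists r; split; rewrite ?num_real// => M rM v /= /andP[_ /le_trans->//]; exact: ltW.
pose f (v : 'rV[R]_k) := h v^T.
have L0 : 0 < `|L| + 1 by rewrite ltr_wpDl.
have fc : continuous f.
  move=> v; apply/(@cvgrPdist_le _ _ _ _ (nbhs_filter v)) => e e0.
  have e'0 : 0 < e / (`|L| + 1) by exact: divr_gt0.
  have /(@cvgrPdist_le _ _ _ _ (nbhs_filter v)) /(_ _ e'0) := @cvg_id _ (nbhs v).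
  apply: filterS => v'.
  rewrite ler_pdivlMr // => vv'.
  have key (x y : 'rV[R]_k) : f x - f y <= (`|L| + 1) * `|x - y|.
    apply: le_trans (hL _ _) _; rewrite -linearB /= norm_tr ler_wpM2r //.
    by rewrite (le_trans (ler_norm _)) // lerDl.
  rewrite ler_norml lerNl opprB mulrC in vv' *.
  by rewrite !(le_trans (key _ _)) // 1?distrC.
have [||c cS cmin] := @EVT_min_rV R k f S _ (bounded_closed_compact Sb Scl).
- by exists u0^T; rewrite /S /= -norm_tr trmxK.
- exact: continuous_subspaceT.
exists c^T; first by move: cS; rewrite inE /S /= norm_tr.
move=> u uP; have := cmin u^T; rewrite /f trmxK; apply.
by rewrite inE /S /= -norm_tr trmxK.
Qed.

(** Norms, and the violation of a homogeneous system of constraints, are both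
sublinear; the two bounds below are used for both. *)
Definition sublinear k (g : 'cV[R]_k -> R) : Prop :=
  (forall u v, g (u + v) <= g u + g v) /\
  (forall a u, 0 <= a -> g (a *: u) = a * g u).

Lemma sublinear_bounded k (g : 'cV[R]_k -> R) : sublinear g ->
  exists2 L, 0 <= L & forall u, g u <= L * `|u|.
Proof.
move=> [gD gZ].
have g0 : g 0 = 0 by have := gZ 0 0 (lexx _); rewrite scale0r mul0r.
pose e i : 'cV[R]_k := delta_mx i 0.
pose l i := `|g (e i)| + `|g (- e i)|.
have l0 i : 0 <= l i by rewrite addr_ge0.
exists (\sum_i l i) => [|u]; first exact: sumr_ge0.
have uE : u = \sum_i u i 0 *: e i.
  by rewrite {1}(matrix_sum_delta u); apply: eq_bigr => i _; rewrite big_ord1.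
have hsum (s : seq 'I_k) (F : 'I_k -> 'cV[R]_k) :
    g (\sum_(i <- s) F i) <= \sum_(i <- s) g (F i).
  elim: s => [|i s IH]; first by rewrite !big_nil g0.
  by rewrite !big_cons; apply: le_trans (gD _ _) _; rewrite lerD2l.
rewrite {1}uE.
apply: le_trans (hsum _ _) _; rewrite mulr_suml; apply: ler_sum => i _.
apply: (@le_trans _ _ (l i * `|u i 0|)); last first.
  by rewrite ler_wpM2l // entry_le_normv.
have [ui|/ltW ui] := leP 0 (u i 0).
  by rewrite gZ // (ger0_norm ui) mulrC ler_wpM2r // (le_trans (ler_norm _)) // lerDl.
rewrite (ler0_norm ui) -{1}[u i 0]opprK scaleNr -scalerN gZ ?oppr_ge0 //.
by rewrite mulrC ler_wpM2r ?oppr_ge0 // (le_trans (ler_norm _)) // lerDr.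
Qed.

(** A sublinear function is Lipschitz, so it attains a minimum on the unit
sphere; positivity away from the origin makes that minimum positive, and
homogeneity carries it to the whole space. *)
Lemma sublinear_coercive k (g : 'cV[R]_k -> R) : sublinear g ->
  (forall u, g u <= 0 -> u = 0) ->
  exists2 delta, 0 < delta & forall u, delta * `|u| <= g u.
Proof.
move=> gsub gpos; have [gD gZ] := gsub.
have [L L0 gL] := sublinear_bounded gsub.
have glip u v : g u - g v <= L * `|u - v|.
  by rewrite lerBlDr (le_trans _ (lerD (gL _) (lexx _))) // -{1}(subrK v u) gD.
have scaled (u : 'cV[R]_k) : u != 0 -> 1 <= `| `|u|^-1 *: u | <= 1.
  move=> u0; rewrite normrZ ger0_norm ?invr_ge0 // mulVf ?lexx //.
  by rewrite normr_eq0.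
have [[u uS]|noS] := pselect (exists u : 'cV[R]_k, 1 <= `|u| <= 1); last first.
  exists 1 => // u; have [->|u0] := eqVneq u 0; last first.
    by case: noS; exists (`|u|^-1 *: u); exact: scaled.
  by have := gZ 0 0 (lexx _); rewrite scale0r mul0r normr0 => ->; rewrite mulr0.
have [c cS cmin] := lipschitz_argmin_shell glip (ex_intro _ u uS).
have gc : 0 < g c.
  rewrite ltNge; apply/negP => /gpos c0; move: cS.
  by rewrite c0 normr0 ler10.
exists (g c) => // v; have [->|v0] := eqVneq v 0.
  by have := gZ 0 0 (lexx _); rewrite scale0r mul0r normr0 => ->; rewrite mulr0.
have nv : 0 < `|v| by rewrite normr_gt0.
have := cmin _ (scaled _ v0); rewrite gZ ?invr_ge0 // => h.
by rewrite mulrC -ler_pdivlMl.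
Qed.

Lemma is_norm_sublinear k (nu : 'cV[R]_k -> R) : is_norm nu -> sublinear nu.
Proof.
move=> [nD nZ _]; split=> // a u a0; by rewrite nZ ger0_norm.
Qed.

Lemma is_norm_ge0 k (nu : 'cV[R]_k -> R) u : is_norm nu -> 0 <= nu u.
Proof.
move=> [nD nZ _]; have := nD u (- u).
have := nZ 0 0; rewrite scale0r normr0 mul0r subrr => ->.
have := nZ (-1) u; rewrite scaleN1r normrN1 mul1r => ->.
by rewrite -mulr2n pmulrn_lge0.
Qed.

Lemma is_norm_equiv k (nu : 'cV[R]_k -> R) : is_norm nu ->
  exists L delta, [/\ 0 <= L, 0 < delta,
    forall u, nu u <= L * `|u| & forall u, delta * `|u| <= nu u].
Proof.
move=> nun; have [L L0 hL] := sublinear_bounded (is_norm_sublinear nun).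
have [|delta d0 hd] := sublinear_coercive (is_norm_sublinear nun).
  move=> u u0; apply: (norm_definite nun); apply/eqP.
  by rewrite eq_le u0 is_norm_ge0.
by exists L, delta.
Qed.

End ColumnVectors.

(** * Total constraint violation and the phase-one problem *)

Lemma bounded_in (R : realType) (V : normedModType R) (T : Type) (K : set T)
    (f : T -> V) :
  [bounded f k | k in K] -> exists M, forall k, K k -> `|f k| <= M.
Proof.
move=> [M [_ hM]]; exists (M + 1) => k; apply: hM; first by rewrite ltrDl.
Qed.

Lemma in_bounded (R : realType) (V : normedModType R) (T : Type) (K : set T)
    (f : T -> V) M :
  (forall k, K k -> `|f k| <= M) -> [bounded f k | k in K].
Proof.
move=> hM; exists M; split; rewrite ?num_real// => M' MM' k /hM h.
exact: le_trans h (ltW MM').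
Qed.

Section Violation.
Variables (R : realType) (n m p : nat) (P : qp R n m p).

Local Notation A := (qpA P).
Local Notation C := (qpC P).

Definition posv k (v : 'cV[R]_k) : 'cV[R]_k := \col_i Num.max 0 (v i 0).
Definition absv k (v : 'cV[R]_k) : 'cV[R]_k := \col_i `|v i 0|.

(** The least infeasibility over the (z, y) that complete [x] to a feasible
point of the augmented problem. The right-hand sides are arguments because the
homogeneous case is the recession function. *)
Definition viol (b : 'cV[R]_m) (d : 'cV[R]_p) (x : 'cV[R]_n) : R :=
  infeasibility (posv (b - A *m x)) (absv (C *m x - d)).

Lemma infeasibilityE (z : 'cV[R]_m) (y : 'cV[R]_p) :
  infeasibility z y = \sum_i z i 0 + \sum_j y j 0.
Proof.
rewrite /infeasibility /ones -col_mx_const dotv_col_mx !dotvE.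
by congr (_ + _); apply: eq_bigr => i _; rewrite mxE mul1r.
Qed.

Lemma infeasibility_le (z1 z2 : 'cV[R]_m) (y1 y2 : 'cV[R]_p) :
  vle z1 z2 -> vle y1 y2 -> infeasibility z1 y1 <= infeasibility z2 y2.
Proof. by move=> zz yy; rewrite !infeasibilityE lerD // ler_sum. Qed.

Lemma infeasibilityD (z1 z2 : 'cV[R]_m) (y1 y2 : 'cV[R]_p) :
  infeasibility (z1 + z2) (y1 + y2) =
  infeasibility z1 y1 + infeasibility z2 y2.
Proof. by rewrite /infeasibility -add_col_mx dotvDr. Qed.

Lemma viol_ge0 b d x : 0 <= viol b d x.
Proof.
by rewrite /viol infeasibilityE addr_ge0 // sumr_ge0 // => i _;
  rewrite !mxE ?le_max ?lexx.
Qed.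

(** Subadditivity holds jointly in the data and the point: this gives
sublinearity of the homogeneous violation, and comparison of any violation
with it. *)
Lemma violD b1 b2 d1 d2 x1 x2 :
  viol (b1 + b2) (d1 + d2) (x1 + x2) <= viol b1 d1 x1 + viol b2 d2 x2.
Proof.
rewrite /viol -infeasibilityD !mulmxDr; apply: infeasibility_le => i.
  rewrite !mxE ge_max addr_ge0 ?le_max ?lexx //=.
  by rewrite opprD addrACA lerD // le_max lexx orbT.
by rewrite !mxE opprD addrACA ler_normD.
Qed.

Lemma violZ a b d x : 0 <= a -> viol (a *: b) (a *: d) (a *: x) = a * viol b d x.
Proof.
move=> a0; rewrite /viol !infeasibilityE mulrDr !mulr_sumr -!scalemxAr.
congr (_ + _); apply: eq_bigr => i _; rewrite !mxE -mulrBr.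
  by rewrite -{1}(mulr0 a) maxr_pMr.
by rewrite normrM ger0_norm.
Qed.

Lemma viol_sublinear : sublinear (viol 0 0).
Proof.
split=> [u v|a u a0]; first by have := violD 0 0 0 0 u v; rewrite !addr0.
by have := violZ 0 0 u a0; rewrite !scaler0.
Qed.

Lemma viol_le0 b d x : viol b d x <= 0 -> vle b (A *m x) /\ C *m x = d.
Proof.
rewrite /viol infeasibilityE => v0.
have pos0 i : 0 <= posv (b - A *m x) i 0 by rewrite mxE le_max lexx.
have abs0 j : 0 <= absv (C *m x - d) j 0 by rewrite mxE.
have S1 : 0 <= \sum_i posv (b - A *m x) i 0 by apply: sumr_ge0.
have S2 : 0 <= \sum_j absv (C *m x - d) j 0 by apply: sumr_ge0.
split=> [i|].
  have /psumr_eq0P/(_ i isT) : \sum_i posv (b - A *m x) i 0 = 0 by lra.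
  move=> /(_ (fun i _ => pos0 i)) /eqP.
  by rewrite mxE eq_le ge_max lexx /= => /andP[h _]; move: h; rewrite !mxE subr_le0.
apply/subr0_eq/colP => j.
have /psumr_eq0P/(_ j isT) : \sum_j absv (C *m x - d) j 0 = 0 by lra.
by move=> /(_ (fun j _ => abs0 j)); rewrite mxE => /normr0_eq0 ->; rewrite mxE.
Qed.

Lemma viol_le_infeasibility x z y : aug_feasible P (x, z, y) ->
  viol (qpb P) (qpd P) x <= infeasibility z y.
Proof.
move=> [h1 h2 h3 h4]; apply: infeasibility_le => i.
  have := h1 i; have := h2 i; rewrite !mxE => z0 az.
  by rewrite ge_max z0 /=; lra.
have := h3 i; have := h4 i; rewrite mulNmx !mxE => c1 c2.
rewrite ler_norml; lra.
Qed.

Lemma viol_aug_feasible x :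
  aug_feasible P (x, posv (qpb P - A *m x), absv (C *m x - qpd P)).
Proof.
split=> i; rewrite ?mulNmx !mxE ?le_max ?lexx //.
- by have [] := leP 0 (qpb P i 0 - (\sum_j A i j * x j 0)) => h; lra.
- by have := ler_norm (- ((\sum_j C i j * x j 0) - qpd P i 0)); rewrite normrN; lra.
- by have := ler_norm ((\sum_j C i j * x j 0) - qpd P i 0); lra.
Qed.

Section Bounded.
Variables (b' : 'cV[R]_m) (dminus dplus : 'cV[R]_p).
Hypothesis S0 : relaxed_feasible P b' dminus dplus !=set0.
Hypothesis Sb : bounded_set (relaxed_feasible P b' dminus dplus).

(** A nonzero direction with A u >= 0 and C u = 0 could be followed forever
inside the relaxed feasible set, which is bounded. *)
Lemma no_recession_direction u : viol 0 0 u <= 0 -> u = 0.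
Proof.
move=> /viol_le0[Au Cu]; have [x0 [h1 h2 h3]] := S0.
have [M hM] := bounded_in Sb.
have ray t : 0 <= t -> `|x0 + t *: u| <= M.
  move=> t0; apply: hM; split; rewrite mulmxDr -scalemxAr ?Cu ?scaler0 ?addr0 //.
  move=> i; rewrite (le_trans (h1 i)) // [leRHS]mxE lerDl mxE mulr_ge0 //.
  by have := Au i; rewrite mxE.
apply/eqP/negP => /negP u0.
have nu : 0 < `|u| by rewrite normr_gt0.
have M0 : 0 <= M by have := ray _ (lexx 0); exact: le_trans.
(* far enough along the ray to leave the ball of radius M *)
pose t := (M + `|x0| + 1) / `|u|.
have t0 : 0 <= t by rewrite divr_ge0 // addr_ge0 // addr_ge0.
have := ray _ t0; have : `|t *: u| <= `|x0 + t *: u| + `|x0|.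
  by have := ler_normB (x0 + t *: u) x0; rewrite addrAC subrr add0r.
rewrite normrZ (ger0_norm t0) /t divfK ?gt_eqF //.
by lra.
Qed.

(** Coercivity of the homogeneous violation, which differs from the violation
of the actual constraints by at most a constant. *)
Lemma aug_x_bound : exists2 K, 0 <= K & forall x z y,
  aug_feasible P (x, z, y) -> `|x| <= K * (1 + infeasibility z y).
Proof.
have [delta d0 hd] := sublinear_coercive viol_sublinear no_recession_direction.
have v0 := viol_ge0 (- qpb P) (- qpd P) 0.
(* the right-hand sides are cancelled by adding the violation of the opposite
   ones at the origin *)
exists (delta^-1 * (1 + viol (- qpb P) (- qpd P) 0)) => [|x z y xzy].
  by rewrite mulr_ge0 ?invr_ge0 ?addr_ge0 // ltW.
rewrite -mulrA ler_pdivlMl // (le_trans (hd _)) //.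
have := violD (qpb P) (- qpb P) (qpd P) (- qpd P) x 0.
rewrite !subrr addr0 => /le_trans; apply.
have := viol_le_infeasibility xzy.
have := viol_ge0 (qpb P) (qpd P) x.
nra.
Qed.

(** Eliminating (z, y) turns the phase-one problem into the unconstrained
minimization of the violation, a Lipschitz and coercive function. *)
Lemma P0_solution_exists : P0_solutions P !=set0.
Proof.
have [K K0 hK] := aug_x_bound.
have [L L0 hL] := sublinear_bounded viol_sublinear.
pose v := viol (qpb P) (qpd P).
have vlip u1 u2 : v u1 - v u2 <= L * `|u1 - u2|.
  rewrite lerBlDr (le_trans _ (lerD (hL _) (lexx _))) //.
  by have := violD 0 (qpb P) 0 (qpd P) (u1 - u2) u2; rewrite !add0r subrK.
have vK x : `|x| <= K * (1 + v x) by exact: hK (viol_aug_feasible x).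
have ball0 : exists u : 'cV[R]_n, 0 <= `|u| <= K * (1 + v 0).
  by exists 0; rewrite normr0 lexx mulr_ge0 // addr_ge0 // viol_ge0.
have [x xB xmin] := lipschitz_argmin_shell vlip ball0.
have {}xmin u : v x <= v u.
  have [uv|vu] := leP (v u) (v 0).
    by rewrite xmin // normr_ge0 (le_trans (vK u)) // ler_wpM2l // lerD2l.
  by rewrite (le_trans _ (ltW vu)) // xmin // normr0 lexx mulr_ge0 // addr_ge0 // viol_ge0.
exists (x, posv (qpb P - A *m x), absv (C *m x - qpd P)).
split=> [|[[x' z'] y'] h]; first exact: viol_aug_feasible.
exact: le_trans (xmin _) (viol_le_infeasibility h).
Qed.

End Bounded.

(** Zero infeasibility would mean zero violation, that is, a feasible point of
(P). Since the minimum is attained, it is therefore positive. *)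
Lemma infeasibility_gt0 x z y : qp_feasible P = set0 ->
  aug_feasible P (x, z, y) -> 0 < infeasibility z y.
Proof.
move=> Pinf xzy; rewrite ltNge; apply/negP => le0.
have : qp_feasible P x by apply/viol_le0/(le_trans (viol_le_infeasibility xzy)).
by rewrite Pinf.
Qed.

End Violation.

(** * The Lagrangian of the augmented problem *)

Section Blocks.
Variable R : realType.

Lemma normv_col_mxl k l (u : 'cV[R]_k) (v : 'cV[R]_l) : `|u| <= `|col_mx u v|.
Proof.
apply/normv_leP => // i.
by have := entry_le_normv (col_mx u v) (lshift l i); rewrite col_mxEu.
Qed.

Lemma normv_col_mxr k l (u : 'cV[R]_k) (v : 'cV[R]_l) : `|v| <= `|col_mx u v|.
Proof.
apply/normv_leP => // i.
by have := entry_le_normv (col_mx u v) (rshift k i); rewrite col_mxEd.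
Qed.

Lemma normv_col_mx_le k l (u : 'cV[R]_k) (v : 'cV[R]_l) e :
  `|u| <= e -> `|v| <= e -> `|col_mx u v| <= e.
Proof.
move=> ue ve; apply/normv_leP => [|i]; first exact: le_trans ue.
by rewrite mxE; case: splitP => j _; apply: le_trans (entry_le_normv _ _) _.
Qed.

Lemma mulmx_bounded k l (M : 'M[R]_(k, l)) :
  exists2 L, 0 <= L & forall u : 'cV[R]_l, `|M *m u| <= L * `|u|.
Proof.
apply: (@sublinear_bounded R l (fun u => `|M *m u|)); split=> [u v|a u a0].
  by rewrite mulmxDr ler_normD.
by rewrite -scalemxAr normrZ ger0_norm.
Qed.

Lemma dotv_ones_diagv k (u v : 'cV[R]_k) :
  dotv (ones R k) (diagv u *m v) = dotv u v.
Proof.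
by rewrite !dotvE; apply: eq_bigr => i _; rewrite mul_diag_mx !mxE mul1r.
Qed.

Lemma diagvE k (u v : 'cV[R]_k) i : (diagv u *m v) i 0 = u i 0 * v i 0.
Proof. by rewrite mul_diag_mx !mxE. Qed.

End Blocks.

Section Lagrangian.
Variables (R : realType) (n m p : nat) (P : qp R n m p).

Local Notation H := (qpH P).
Local Notation c := (qpc P).
Local Notation A := (qpA P).
Local Notation C := (qpC P).

Definition dual_value (w : iterate R n m p) : R :=
  dotv (qpb P) (it_pi w) + dotv (qpd P) (it_eta w - it_zeta w).

Definition dual_comb (w : iterate R n m p) : 'cV[R]_n :=
  A^T *m it_pi w + C^T *m (it_eta w - it_zeta w).

Lemma qp_obj_ge : sym_psd H ->
  exists2 c1, 0 <= c1 & forall x, - (c1 * `|x|) <= qp_obj P x.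
Proof.
move=> [_ Hpsd]; exists (n%:R * `|c|) => [|x]; first exact: mulr_ge0.
have := normr_dotv_le c x; rewrite ler_norml /qp_obj => /andP[h _].
by have := Hpsd x; rewrite -mulrA; lra.
Qed.

Lemma complementarity_total w :
  dotv (ones R _) (G1 P w) =
  dotv (slack_s P w) (it_pi w) + dotv (it_z w) (it_xi w) +
  dotv (slack_tp P w) (it_eta w) + dotv (slack_tm P w) (it_zeta w).
Proof.
have onesE k l : ones R (k + l) = col_mx (ones R k) (ones R l).
  by rewrite /ones col_mx_const.
by rewrite /G1 !onesE !dotv_col_mx !dotv_ones_diagv !addrA.
Qed.

(** The Lagrangian of the phase-one problem scaled by [phi], reorganized so
that each remainder is a residual of the optimality system: stationarity in x,
in z and in y, then total complementarity. It holds for an arbitrary pairing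
of a primal point with multipliers: at the iterate it evaluates the dual
objective, and at a feasible point, where the complementarity term is
nonnegative, it is weak duality. *)
Lemma lagrangian_identity phi w :
  dual_value w = phi * infeasibility (it_z w) (it_y w)
    + dotv (it_x w) (dual_comb w)
    + dotv (it_z w) (it_pi w + it_xi w - phi *: ones R m)
    + dotv (it_y w) (it_eta w + it_zeta w - phi *: ones R p)
    - dotv (ones R _) (G1 P w).
Proof.
have -> : infeasibility (it_z w) (it_y w)
    = dotv (ones R m) (it_z w) + dotv (ones R p) (it_y w).
  by rewrite /infeasibility {1}/ones -col_mx_const dotv_col_mx.
rewrite complementarity_total /dual_value /dual_comb /slack_s /slack_tp /slack_tm.
rewrite !mulNmx !(dotvDl, dotvDr, dotvNl, dotvNr, dotvZr) !dotv_mulmxl.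
rewrite !mulmxBr !(dotvDr, dotvNr) (dotvC (ones R m)) (dotvC (ones R p)).
by ring.
Qed.

Definition dual_ge0 (w : iterate R n m p) : Prop := vle 0 (it_dual w).

Lemma dual_ge0P w : dual_ge0 w ->
  [/\ vle 0 (it_pi w), vle 0 (it_xi w), vle 0 (it_eta w) & vle 0 (it_zeta w)].
Proof.
rewrite /dual_ge0 /it_dual -!col_mx0.
by move=> /vle_col_mx[? /vle_col_mx[? /vle_col_mx[]]].
Qed.

Definition it_feasible (w : iterate R n m p) : Prop :=
  aug_feasible P (it_x w, it_z w, it_y w).

Lemma slack_ge0 w : it_feasible w ->
  [/\ vle 0 (slack_s P w), vle 0 (it_z w), vle 0 (slack_tp P w)
    & vle 0 (slack_tm P w)].
Proof.
move=> [h1 h2 h3 h4]; split=> // i; rewrite /slack_s /slack_tp /slack_tm.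
- by have := h1 i; rewrite !mxE subr_ge0.
- by have := h3 i; rewrite !mxE subr_ge0.
- by have := h4 i; rewrite !mxE -subr_ge0 opprK.
Qed.

Lemma y_ge0 w : it_feasible w -> vle 0 (it_y w).
Proof.
by move=> [_ _ h3 h4] i; have := h3 i; have := h4 i;
  rewrite mulNmx !mxE; lra.
Qed.

Lemma complementarity_ge0 w : it_feasible w -> dual_ge0 w ->
  0 <= dotv (ones R _) (G1 P w).
Proof.
move=> /slack_ge0[s z tp tm] /dual_ge0P[? ? ? ?].
by rewrite complementarity_total !addr_ge0 ?dotv_ge0.
Qed.

Lemma aug_convex phi : sym_psd H -> cqp_convex (aug P phi).
Proof.
move=> [Hs Hp]; split; first by rewrite /= tr_block_mx Hs !trmx0.
move=> u; rewrite -[u]vsubmxK /= mul_block_col !mul0mx !addr0 dotv_col_mx.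
by rewrite {2}/dotv mulmx0 mxE addr0.
Qed.

Lemma G1_complE phi w :
  cqp_compl (aug P phi) (it_primal w) (it_dual w) = G1 P w.
Proof.
rewrite /cqp_compl /G1 /it_primal /it_dual /= !mul_col_mx !mul_row_col.
rewrite !mul1mx !mul0mx !(addr0, add0r) !opp_col_mx !add_col_mx subr0 opprK.
by rewrite /diagv !tr_col_mx !diag_mx_row !mul_block_col !mul0mx !(addr0, add0r).
Qed.

Lemma cqp_gradE phi w :
  cqp_grad (aug P phi) (it_primal w) (it_dual w) =
  col_mx (dual_resid P w)
    (- col_mx (it_pi w + it_xi w - phi *: ones R m)
              (it_eta w + it_zeta w - phi *: ones R p)).
Proof.
rewrite /cqp_grad /it_primal /it_dual /= mul_block_col !mul0mx !addr0.
rewrite !tr_col_mx !tr_row_mx !mul_row_col !mul_col_mx !trmx1 !trmx0.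
rewrite !mul1mx !mul0mx.
rewrite {1}/ones -col_mx_const scale_col_mx !add_col_mx.
rewrite !(addr0, add0r) !opp_col_mx !add_col_mx linearN /= mulNmx.
congr col_mx; first by rewrite /dual_resid mulmxBr opprD !addrA.
by congr col_mx; apply/colP=> i; rewrite !mxE; ring.
Qed.

(** [G2] and the gradient of the Lagrangian differ only by the sign of the (z,
y) block. *)
Lemma norm_G2_le phi w :
  `|G2 P phi w| <= `|cqp_grad (aug P phi) (it_primal w) (it_dual w)|.
Proof.
rewrite cqp_gradE /G2; apply: normv_col_mx_le; first exact: normv_col_mxl.
by rewrite -normrN; exact: normv_col_mxr.
Qed.

End Lagrangian.

(** * Iterates as pieces of base-iteration runs *)

Section MasterIterates.
Variables (R : realType) (n m p : nat) (P : qp R n m p).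
Hypothesis H_psd : sym_psd (qpH P).
Variable norm : forall k : nat, 'cV[R]_k -> R.
Variables (B : base_iteration R) (upd : R -> iterate R n m p -> R).
Hypothesis B_base : is_base_iteration norm B.
Variables (w : nat -> iterate R n m p) (phi : nat -> R).
Hypothesis w_master : master_generated P B upd w phi.

Local Notation q k := (aug P (phi k)).

Lemma run_iter N M (q : cqp R N M) r l j : @bi_run R B N M q r ->
  r (l + j)%N = iter j (bi_step q) (r l).
Proof. by move=> [_ _ rS]; elim: j => [|j IH]; rewrite ?addn0 ?addnS //= rS IH. Qed.

Lemma orbit_run N M (q : cqp R N M) c0 : bi_init q c0 -> vle 0 c0.2 ->
  @bi_run R B N M q (fun i => iter i (bi_step q) c0).
Proof. by []. Qed.

(** The properties of a base iteration are stated along runs from an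
admissible start, whereas a master iteration may resume in the middle of one;
so each master iteration has to be located within a full run for its penalty
value. *)
Lemma master_step_in_run : forall k, exists r l j,
  [/\ bi_run (q k.+1) r,
      (r l).1.2 = it_primal (w k) /\ (r l).2 = it_dual (w k)
    & exists s : bi_state B,
        r (l + j)%N = (s, it_primal (w k.+1), it_dual (w k.+1))].
Proof.
have [_ dual0 _ _ [s steps]] := w_master; have [dual_pos _ _ _] := B_base.
suff step k : exists r l j, [/\ bi_run (q k.+1) r,
    (r l).1.2 = it_primal (w k) /\ (r l).2 = it_dual (w k)
    & r (l + j)%N = (s k.+1, it_primal (w k.+1), it_dual (w k.+1))].
  move=> k; have [r [l [j [h1 h2 h3]]]] := step k.
  by exists r, l, j; split => //; exists (s k.+1).
elim: k => [|k [r [l [j [rrun _ rlj]]]]].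
  have [s0 [j /= [init _ _ _ stepj]]] := steps 0%N.
  by exists (fun i => iter i (bi_step (q 1)) (s0, it_primal (w 0), it_dual (w 0))), 0%N, j.
have [s0 [j' /= [init _ _ _ stepj]]] := steps k.+1; move: init.
case: eqVneq => [phiE s0E|_ init].
  rewrite phiE s0E -rlj in stepj; rewrite phiE; exists r, (l + j)%N, j'.
  by split; rewrite ?rlj // (run_iter _ _ rrun) stepj.
exists (fun i => iter i (bi_step (q k.+2)) (s0, it_primal (w k.+1), it_dual (w k.+1))), 0%N, j'.
split=> //; apply: orbit_run => //=.
by have := dual_pos _ _ _ _ (aug_convex _ H_psd) rrun (l + j)%N; rewrite rlj.
Qed.

Lemma master_dual_ge0 k : dual_ge0 (w k).
Proof.
have [_ dual0 _ _ _] := w_master; have [dual_pos _ _ _] := B_base.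
case: k => [//|k]; have [r [l [j [rrun _ [s rlj]]]]] := master_step_in_run k.
by have := dual_pos _ _ _ _ (aug_convex _ H_psd) rrun (l + j)%N; rewrite rlj.
Qed.

(** The constraints of the augmented problem do not depend on the penalty
parameter, so a property kept by each base step survives penalty changes. *)
Lemma master_invariant (Q : 'cV[R]_(n + (m + p)) -> Prop) :
  (forall k r, bi_run (B := B) (q k) r ->
     forall l, Q (r l).1.2 -> Q (r l.+1).1.2) ->
  Q (it_primal (w 0)) -> forall k, Q (it_primal (w k)).
Proof.
move=> Qstep Q0; elim=> [//|k IH].
have [r [l [j [rrun [rl _] [s rlj]]]]] := master_step_in_run k.
have -> : it_primal (w k.+1) = (r (l + j)%N).1.2 by rewrite rlj.
elim: j {rlj} => [|j IHj]; first by rewrite addn0 rl.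
by rewrite addnS; exact: (Qstep k.+1).
Qed.

Lemma master_feasible k : it_feasible P (w k).
Proof.
have [init _ _ _ _] := w_master; have [_ bi1 _ _] := B_base.
apply/(aug_feasibleE P (phi 0)); move: k.
have by_feasible : BI1_feasible B ->
    cqp_feasible (q 0) (it_primal (w 0)) ->
    forall k, cqp_feasible (q 0) (it_primal (w k)).
  move=> bf f0; apply: master_invariant f0 => k r rrun l.
  by have := bf _ _ _ _ (aug_convex (phi k) H_psd) rrun l.
case: init => [strict0|[bf f0]]; last exact: by_feasible.
have strictW u : cqp_strict (q 0) u -> cqp_feasible (q 0) u.
  by move=> h i; exact: ltW.
case: bi1 => [bf|bs]; first exact/by_feasible/strictW.
move=> k; apply: strictW; move: k; apply: master_invariant strict0 => k r rrun l.
by have := bs _ _ _ _ (aug_convex (phi k) H_psd) rrun l.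
Qed.

Lemma master_descent k :
  qp_obj P (it_x (w k.+1))
    + phi k.+1 * infeasibility (it_z (w k.+1)) (it_y (w k.+1))
  <= qp_obj P (it_x (w k)) + phi k.+1 * infeasibility (it_z (w k)) (it_y (w k)).
Proof.
have [_ _ _ _ [s steps]] := w_master.
have [s0 [j /= [_ _ _ + stepj]]] := steps k.
by rewrite stepj /= !aug_objE.
Qed.

Section ConstantPenalty.
Variable phihat : R.
Hypothesis phi_const : \forall k \near \oo, phi k = phihat.

Lemma last_penalty_change :
  exists k0, (forall k, (k0 < k)%N -> phi k = phihat) /\
             ((0 < k0)%N -> phi k0.+1 <> phi k0).
Proof.
have [N _ hN] := phi_const.
have {hN} : forall k, (N < k)%N -> phi k = phihat by move=> k /ltnW; exact: hN.
elim: N => [|N IH] hN; first by exists 0%N.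
have [phiN|phiN] := eqVneq (phi N.+1) phihat.
  by apply: IH => k; rewrite leq_eqVlt => /orP[/eqP <-|/hN].
by exists N.+1; split => // _ /esym; rewrite (hN N.+2) //; exact/eqP.
Qed.

(** After the last penalty change the iterates belong to one run, and they are
exactly its record lows: a master iteration skips the base iterates above the
current objective value and stops at the first one that is not. *)
Lemma tail_run : exists k0 r, bi_run (B := B) (aug P phihat) r /\
  forall i, exists l,
  [/\ (i < l)%N,
      (r l).1.2 = it_primal (w (k0 + i).+1) /\ (r l).2 = it_dual (w (k0 + i).+1),
      record_lows (aug P phihat) (fun l => (r l).1.2) l
    & forall l', (l' <= l)%N ->
        record_lows (aug P phihat) (fun l => (r l).1.2) l' ->
        exists k, (r l').1.2 = it_primal (w k)].
Proof.
have [_ _ _ _ [s steps]] := w_master.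
have [k0 [tail change]] := last_penalty_change.
have [s0 [j0 /= [init high0 j0pos low0 stepj0]]] := steps k0.
rewrite (tail k0.+1) // in init high0 low0 stepj0.
set qh := aug P phihat in init high0 low0 stepj0 *.
pose r i := iter i (bi_step qh) (s0, it_primal (w k0), it_dual (w k0)).
have rrun : bi_run (B := B) qh r.
  apply: orbit_run; last exact: master_dual_ge0.
  move: init; case: (posnP k0) => [->//|k00] /=.
  case: eqP => // e; case: (change k00).
  by rewrite tail.
pose obj l := cqp_obj qh (r l).1.2.
(* the internal state is only known to match after the first master step of
   the run, since the run may start from a fresh state *)
suff main i : exists l,
  [/\ (i < l)%N,
      r l = (s (k0 + i).+1, it_primal (w (k0 + i).+1), it_dual (w (k0 + i).+1)),
      record_lows qh (fun l => (r l).1.2) l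
    & forall l', (l' <= l)%N -> record_lows qh (fun l => (r l).1.2) l' ->
        exists k, (r l').1.2 = it_primal (w k)].
  exists k0, r; split=> // i; have [l [h1 h2 h3 h4]] := main i.
  by exists l; split => //; rewrite h2.
elim: i => [|i [l [il rl [l0 low] all_master]]].
  exists j0; rewrite addn0; split=> //.
    split=> // l; case: (posnP l) => [->//|l0] lj.
    by apply: le_trans low0 (ltW (high0 l _)); rewrite l0.
  move=> l'; rewrite leq_eqVlt => /orP[/eqP->|lt] [l'0 lows].
    by exists k0.+1; rewrite /r stepj0.
  have := high0 l'; rewrite l'0 lt => /(_ isT).
  by rewrite ltNge (lows 0%N).
have [s1 [j /= [s1E high jpos lowj stepj]]] := steps (k0 + i).+1.
rewrite !tail ?ltnS ?leqW ?leq_addr // eqxx /= in s1E high lowj stepj.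
rewrite s1E -rl -/qh in high lowj stepj.
have rj i' : iter i' (bi_step qh) (r l) = r (l + i')%N by rewrite (run_iter _ _ rrun).
have objl : cqp_obj qh (it_primal (w (k0 + i).+1)) = obj l by rewrite /obj rl.
rewrite rj objl in lowj; rewrite rj in stepj.
have {}high i' : (0 < i' < j)%N -> obj l < obj (l + i')%N.
  by move=> /high; rewrite rj objl.
have cases l' : (l' <= l + j)%N ->
    [\/ (l' <= l)%N, obj l < obj l' | l' = (l + j)%N].
  rewrite leq_eqVlt => /orP[/eqP->|lt]; first by constructor 3.
  have [ll|ll] := leqP l' l; first by constructor 1.
  constructor 2; rewrite -(subnKC (ltnW ll)); apply: high.
  by rewrite subn_gt0 ll ltn_subLR // ltnW.
exists (l + j)%N; rewrite addnS; split.
- by rewrite -addn1 leq_add.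
- by [].
- split; first by rewrite addn_gt0 l0.
  move=> l' lt; have [l'l|up|l'E] := cases l' (ltnW lt).
  + apply: le_trans lowj _; move: l'l; rewrite leq_eqVlt => /orP[/eqP->//|].
    exact: low.
  + exact/(le_trans lowj)/ltW.
  + by move: lt; rewrite l'E ltnn.
- move=> l' lt lowl'; have [l'l|up|->] := cases l' lt; first exact: all_master.
    have [ll|ll] := ltnP l l'; last exact: all_master.
    by have [_ /(_ _ ll)] := lowl'; rewrite leNgt up.
  by exists (k0 + i).+2; rewrite stepj.
Qed.

End ConstantPenalty.
End MasterIterates.

(** * Sequences *)

Section Sequences.
Variable R : realType.

Lemma cvg0P (u : nat -> R) : u k @[k --> \oo] --> (0 : R) <->
  forall e, 0 < e -> exists N, forall k, (N <= k)%N -> `|u k| <= e.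
Proof.
split=> [/cvgrPdist_le h e /h[N _ hN]|h].
  by exists N => k /hN; rewrite sub0r normrN.
by apply/cvgrPdist_le => e /h[N hN]; exists N => // k /hN; rewrite sub0r normrN.
Qed.

Lemma is_norm_cvg0 l (nu : 'cV[R]_l -> R) (v : nat -> 'cV[R]_l) e :
  is_norm nu -> nu (v k) @[k --> \oo] --> (0 : R) -> 0 < e ->
  exists N, forall k, (N <= k)%N -> `|v k| <= e.
Proof.
move=> nun cv e0; have [L [delta [_ d0 _ hd]]] := is_norm_equiv nun.
have [N hN] := (cvg0P _).1 cv _ (mulr_gt0 d0 e0); exists N => k /hN.
rewrite ger0_norm ?is_norm_ge0 // => h; rewrite -(ler_pM2l d0).
exact: le_trans (hd _) h.
Qed.

(** The strict inequality leaves room for a margin that does not depend on k.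
*)
Lemma limn_einf_lt (u : nat -> R) a : (limn_einf (fun k => (u k)%:E) < a%:E)%E ->
  exists2 r, r < a & forall N, exists2 k, (N <= k)%N & u k < r.
Proof.
have /cvg_lim := @cvg_einfs_sup R (fun k => (u k)%:E).
rewrite limn_einf_lim => -> // h.
have [r ra hr] : exists2 r, r < a &
    (ereal_sup (range (einfs (fun k => (u k)%:E))) < r%:E)%E.
  move: h; case: (ereal_sup _) => [s| |]; rewrite ?lte_fin ?ltNge ?leey //.
    move=> sa; exists ((s + a) / 2); rewrite -?ltNge ?lte_fin; lra.
  by move=> _; exists (a - 1); rewrite -?ltNge ?ltNyr //; lra.
exists r => // N.
have : (einfs (fun k => (u k)%:E) N < r%:E)%E.
  by apply: le_lt_trans hr; apply: ereal_sup_ubound; exists N.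
by move=> /ereal_inf_lt[_ [k Nk <-]]; rewrite lte_fin => ?; exists k.
Qed.

Lemma infinite_cofinal (K : set nat) N : infinite_set K ->
  exists2 k, K k & (N <= k)%N.
Proof.
move=> Kinf; apply: contrapT => h; apply: Kinf.
apply: (sub_finite_set _ (finite_II N)) => k Kk.
by rewrite /= ltnNge; apply/negP => Nk; apply: h; exists k.
Qed.

Lemma eventually_bounded (u : nat -> R) N M : (forall k, 0 <= u k) ->
  (forall k, (N <= k)%N -> u k <= M) -> exists M', forall k, u k <= M'.
Proof.
move=> u0 hM; exists (\sum_(i < N) u i + `|M|) => k.
have [Nk|kN] := leqP N k.
  by rewrite (le_trans (hM _ Nk)) // (le_trans (ler_norm _)) // lerDr sumr_ge0.
by rewrite (bigD1 (Ordinal kN)) //= -addrA lerDl addr_ge0 // sumr_ge0.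
Qed.

End Sequences.

(** * Infeasibility near a stationary point with small multipliers *)

Section Infeasibility.
Variables (R : realType) (n m p : nat) (P : qp R n m p).

Lemma infeasibility_le_norm (z : 'cV[R]_m) (y : 'cV[R]_p) M :
  (forall i, z i 0 <= M) -> (forall j, y j 0 <= M) ->
  infeasibility z y <= (m + p)%:R * M.
Proof.
move=> zM yM; rewrite infeasibilityE natrD mulrDl; apply: lerD.
  rewrite mulr_natl -[X in M *+ X]card_ord -sumr_const; exact: ler_sum.
rewrite mulr_natl -[X in M *+ X]card_ord -sumr_const; exact: ler_sum.
Qed.

Lemma norm_zy_le w : it_feasible P w ->
  `|col_mx (it_z w) (it_y w)| <= infeasibility (it_z w) (it_y w).
Proof.
move=> wf; have [_ z0 _ _] := slack_ge0 wf; have y0 := y_ge0 wf.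
have {}z0 i : 0 <= it_z w i 0 by have := z0 i; rewrite mxE.
have {}y0 i : 0 <= it_y w i 0 by have := y0 i; rewrite mxE.
have S1 : 0 <= \sum_i it_z w i 0 by exact: sumr_ge0.
have S2 : 0 <= \sum_i it_y w i 0 by exact: sumr_ge0.
rewrite infeasibilityE; apply/normv_leP => [|i]; first exact: addr_ge0.
rewrite mxE; case: splitP => j _; rewrite ger0_norm //.
  rewrite (@le_trans _ _ (\sum_i it_z w i 0)) ?lerDl //.
  by rewrite (bigD1 j) //= lerDl sumr_ge0.
rewrite (@le_trans _ _ (\sum_i it_y w i 0)) ?lerDr //.
by rewrite (bigD1 j) //= lerDl sumr_ge0.
Qed.

(** If the multipliers pi and eta - zeta stay below [r] < [phi],
near-stationarity in z and y forces xi, eta and zeta to be bounded away from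
0; near-complementarity then makes z and the slacks of the two inequalities
for C x = d small, and y is the half-sum of those slacks. [kappa] measures the
residuals relative to the margin. *)
Lemma infeasibility_small phi r kappa w : it_feasible P w -> dual_ge0 w ->
  0 < phi - r -> 0 <= kappa <= 1 ->
  `|eq_dual w| <= r ->
  `|G1 P w| <= (phi - r) / 2 * kappa -> `|G2 P phi w| <= (phi - r) / 2 * kappa ->
  infeasibility (it_z w) (it_y w) <= (m + p)%:R * (2 * kappa).
Proof.
move=> wf /dual_ge0P[pi0 xi0 eta0 zeta0] rphi /andP[k0 k1] eqd g1 g2.
have [s0 z0 tp0 tm0] := slack_ge0 wf.
set g := (phi - r) / 2 in g1 g2; have g0 : 0 < g by rewrite /g; lra.
have gk : g * kappa <= g by rewrite ger_pMr.
have [pir omr] : `|it_pi w| <= r /\ `|it_eta w - it_zeta w| <= r.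
  by split; apply: le_trans eqd; [exact: normv_col_mxl|exact: normv_col_mxr].
have div a b : 0 <= a -> g <= b -> a * b <= g * kappa -> a <= kappa.
  by move=> a0 gb ab; rewrite -(ler_pM2l g0); nra.
have {g2} g2 := le_trans (normv_col_mxr _ _) g2.
have g2z := le_trans (normv_col_mxl _ _) g2.
have g2y := le_trans (normv_col_mxr _ _) g2.
have {g1} g1 := le_trans (normv_col_mxr _ _) g1.
have g1z := le_trans (normv_col_mxl _ _) g1.
have {g1} g1 := le_trans (normv_col_mxr _ _) g1.
have g1p := le_trans (normv_col_mxl _ _) g1.
have g1m := le_trans (normv_col_mxr _ _) g1.
apply: infeasibility_le_norm => i.
  have := le_trans (entry_le_normv _ i) g1z; rewrite diagvE ler_norml => /andP[_ h].
  have := le_trans (entry_le_normv _ i) g2z; rewrite !mxE ler_norml => /andP[h' _].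
  have := le_trans (entry_le_normv _ i) pir; rewrite ler_norml => /andP[_ hpi].
  have zi : 0 <= it_z w i 0 by have := z0 i; rewrite mxE.
  have xi_ge : g <= it_xi w i 0 by rewrite /g in gk h' *; lra.
  by have := div _ _ zi xi_ge h; lra.
have := le_trans (entry_le_normv _ i) g1p; rewrite diagvE ler_norml => /andP[_ hp].
have := le_trans (entry_le_normv _ i) g1m; rewrite diagvE ler_norml => /andP[_ hm].
have := le_trans (entry_le_normv _ i) g2y; rewrite !mxE ler_norml => /andP[h' _].
have := le_trans (entry_le_normv _ i) omr; rewrite !mxE ler_norml => /andP[h1 h2].
have tpi : 0 <= slack_tp P w i 0 by have := tp0 i; rewrite mxE.
have tmi : 0 <= slack_tm P w i 0 by have := tm0 i; rewrite mxE.
have etag : g <= 2 * it_eta w i 0 by rewrite /g in gk h' *; lra.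
have zetag : g <= 2 * it_zeta w i 0 by rewrite /g in gk h' *; lra.
have dp := div (slack_tp P w i 0 / 2) _ (divr_ge0 tpi (ler0n _ _)) etag.
have dm := div (slack_tm P w i 0 / 2) _ (divr_ge0 tmi (ler0n _ _)) zetag.
have {dp} : slack_tp P w i 0 / 2 <= kappa by apply: dp; lra.
have {dm} : slack_tm P w i 0 / 2 <= kappa by apply: dm; lra.
rewrite /slack_tp /slack_tm mulNmx !mxE; lra.
Qed.

End Infeasibility.

(** * Behaviour of the penalty parameter *)

Section Penalty.
Variables (R : realType) (n m p : nat) (P : qp R n m p).
Hypothesis H_psd : sym_psd (qpH P).
Variables (b' : 'cV[R]_m) (dminus dplus : 'cV[R]_p).
Hypothesis S0 : relaxed_feasible P b' dminus dplus !=set0.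
Hypothesis Sb : bounded_set (relaxed_feasible P b' dminus dplus).
Variable norm : forall k : nat, 'cV[R]_k -> R.
Hypothesis norm_norm : forall k : nat, is_norm (@norm k).
Variables (B : base_iteration R) (upd : R -> iterate R n m p -> R).
Hypothesis B_base : is_base_iteration norm B.
Variables (w : nat -> iterate R n m p) (phi : nat -> R).
Hypothesis w_master : master_generated P B upd w phi.

Let w_feasible k : it_feasible P (w k).
Proof. exact: (master_feasible H_psd B_base w_master). Qed.

Let w_dual_ge0 k : dual_ge0 (w k).
Proof. exact: (master_dual_ge0 H_psd B_base w_master). Qed.

Local Notation theta k := (infeasibility (it_z (w k)) (it_y (w k))).

Let theta_ge0 k : 0 <= theta k.
Proof. exact: le_trans (norm_zy_le (w_feasible k)). Qed.

Lemma x_bounded M : (forall k, theta k <= M) ->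
  exists2 X, 0 <= X & forall k, `|it_x (w k)| <= X.
Proof.
move=> hM; have [K K0 hK] := aug_x_bound S0 Sb.
exists (K * (1 + M)) => [|k].
  by rewrite mulr_ge0 // addr_ge0 // (le_trans (theta_ge0 0)).
by rewrite (le_trans (hK _ _ _ (w_feasible k))) // ler_wpM2l // lerD2l hM.
Qed.

Lemma theta_bounded : bounded_zy w -> exists M, forall k, theta k <= M.
Proof.
move=> /bounded_in[M hM]; exists ((m + p)%:R * M) => k.
have zy := hM k I; apply: infeasibility_le_norm => i.
  rewrite (le_trans (ler_norm _)) // (le_trans (entry_le_normv _ _)) //.
  exact: le_trans (normv_col_mxl _ _) zy.
rewrite (le_trans (ler_norm _)) // (le_trans (entry_le_normv _ _)) //.
exact: le_trans (normv_col_mxr _ _) zy.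
Qed.

Section Constant.
Variable phihat : R.
Hypothesis phi_const : \forall k \near \oo, phi k = phihat.
Hypothesis zy_bounded : bounded_zy w.

Lemma tail_stationarity e : 0 < e -> exists N, forall k, (N <= k)%N ->
  norm (G1 P (w k)) <= e /\
  norm (cqp_grad (aug P phihat) (it_primal (w k)) (it_dual (w k))) <= e.
Proof.
move=> e0; have [_ _ _ bi3] := B_base.
have [k0 [r [rrun follow]]] := tail_run H_psd B_base w_master phi_const.
have [M thetaM] := theta_bounded zy_bounded.
have [X X0 hX] := x_bounded thetaM.
have Kbounded : [bounded (r l).1.2 | l in
    record_lows (aug P phihat) (fun l => (r l).1.2)].
  apply: (@in_bounded _ _ _ _ _ (Num.max X M)) => l lK.
  have [l' [/ltnW ll' _ _ /(_ l ll' lK)[k ->]]] := follow l.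
  apply: normv_col_mx_le; first by rewrite le_max hX.
  by rewrite (le_trans (norm_zy_le (w_feasible k))) // le_max thetaM orbT.
have /cvgrPdist_le/(_ e e0) := bi3 _ _ _ _ (aug_convex phihat H_psd) rrun Kbounded.
move=> [N _ hN]; exists (k0 + N).+1 => k Nk.
have [i Ni kE] : exists2 i, (N <= i)%N & k = (k0 + i).+1.
  exists (k - k0.+1)%N; last by rewrite -addSn subnKC // (leq_trans _ Nk) ?ltnS ?leq_addr.
  by rewrite leq_subRL ?addSn // (leq_trans _ Nk) ?ltnS ?leq_addr.
have [l [il [rl1 rl2] lK _]] := follow i.
have Nl : (N <= l)%N by exact: leq_trans (ltnW il).
have := hN l Nl lK; rewrite rl1 rl2 -kE G1_complE sub0r normrN.
by move=> /(le_trans (ler_norm _)); rewrite ge_max => /andP[].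
Qed.

(** The hypotheses of [PU3]: the first two residuals come from stationarity of
the base iteration, the third from boundedness of x. *)
Lemma tail_residuals :
  [/\ norm (G1 P (w k)) @[k --> \oo] --> (0 : R),
      norm (G2 P (phi k) (w k)) @[k --> \oo] --> (0 : R)
    & `|G3 P (w k)| @[k --> \oo] --> (0 : R)].
Proof.
have [M thetaM] := theta_bounded zy_bounded.
have [X X0 hX] := x_bounded thetaM.
have [Nc _ hNc] := phi_const.
have [L [delta [L0 d0 hL hd]]] := is_norm_equiv (@norm_norm (n + (m + p))).
have G2small e : 0 < e -> exists N, forall k, (N <= k)%N ->
    `|G2 P (phi k) (w k)| <= e.
  move=> e0; have [N hN] := tail_stationarity (mulr_gt0 d0 e0).
  exists (maxn N Nc) => k; rewrite geq_max => /andP[/hN[_ h] /hNc ->].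
  rewrite (le_trans (norm_G2_le _ _ _)) // -(ler_pM2l d0).
  exact: le_trans (hd _) h.
split; apply/cvg0P => e e0.
- have [N hN] := tail_stationarity e0; exists N => k /hN[h _].
  by rewrite ger0_norm // is_norm_ge0.
- have [|N hN] := G2small (e / (L + 1)); first by rewrite divr_gt0 // ltr_wpDl.
  exists N => k /hN h; rewrite ger0_norm ?is_norm_ge0 // (le_trans (hL _)) //.
  rewrite (le_trans (ler_wpM2l L0 h)) // mulrCA ger_pMr // ler_pdivrMr ?ltr_wpDl //.
  by rewrite mul1r lerDl.
- have nX : 0 < n%:R * X + 1 by rewrite ltr_wpDl // mulr_ge0.
  pose e' := e / (n%:R * X + 1).
  have eE : e = e' * (n%:R * X + 1) by rewrite divfK ?gt_eqF.
  have e'0 : 0 < e' by rewrite divr_gt0.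
  have [N hN] := G2small e' e'0.
  exists N => k /hN h; rewrite normr_id (le_trans (normr_dotv_le _ _)) //.
  have {}h := le_trans (normv_col_mxl _ _) h.
  apply: (@le_trans _ _ (n%:R * (e' * X))); last by rewrite eE; lra.
  by rewrite ler_wpM2l // ler_pM.
Qed.

End Constant.

(** With a constant penalty, [PU3] yields infinitely many near-stationary
iterates whose multipliers are below the penalty by a margin; their
infeasibility would be arbitrarily small, yet it is at least the positive
optimal value of the phase-one problem. *)
Lemma penalty_unbounded : qp_feasible P = set0 ->
  PU1 phi -> PU2 w phi -> PU3 P norm w phi -> phi k @[k --> \oo] --> +oo.
Proof.
move=> Pinf [phi0 _ [[phihat phi_const]|//]] pu2 pu3.
have [zyb|] := pselect (bounded_zy w); last exact: pu2.
exfalso.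
have [g1 g2 g3] := tail_residuals phi_const zyb.
have [r rphi often] := limn_einf_lt (pu3 _ phi_const g1 g2 g3).
have [[[xh zh] yh] [hf hmin]] := P0_solution_exists S0 Sb.
have mu0 := infeasibility_gt0 Pinf hf; set mu := infeasibility zh yh in mu0.
pose M : R := (m + p)%:R; have M0 : 0 <= M by exact: ler0n.
(* chosen so that (m + p) * 2 kappa < mu, contradicting [infeasibility_small] *)
pose kappa := Num.min 1 (mu / (2 * M + 1)).
have M1 : 0 < 2 * M + 1 by lra.
have kappa0 : 0 < kappa by rewrite lt_min ltr01 divr_gt0.
have kappa1 : kappa <= 1 by rewrite ge_min lexx.
have kappaM : kappa * (2 * M + 1) <= mu.
  by rewrite -ler_pdivlMr // ge_min lexx orbT.
pose e := (phihat - r) / 2 * kappa.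
have e0 : 0 < e by rewrite mulr_gt0 // divr_gt0 // subr_gt0.
have [N1 hN1] := is_norm_cvg0 (@norm_norm _) g1 e0.
have [N2 hN2] := is_norm_cvg0 (@norm_norm _) g2 e0.
have [N3 _ hN3] := phi_const.
have [k] := often (maxn N1 (maxn N2 N3)).
rewrite !geq_max => /and3P[/hN1 G1k /hN2 G2k /hN3 phik] /ltW eqdk.
rewrite phik in G2k.
have := infeasibility_small (w_feasible k) (w_dual_ge0 k) _ _ eqdk G1k G2k.
rewrite subr_gt0 rphi (ltW kappa0) kappa1 => /(_ isT isT).
have : mu <= theta k by exact: (hmin (it_x (w k), it_z (w k), it_y (w k))) (w_feasible k).
rewrite -/M; nra.
Qed.

Section Unbounded.
Hypothesis phi_mono : nondecreasing_seq phi.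
Hypothesis phi_pinfty : phi k @[k --> \oo] --> +oo.

Let phi_large c : exists N, forall k, (N <= k)%N -> c <= phi k.
Proof. by have [N _ hN] := (cvgryPge _).1 phi_pinfty c; exists N. Qed.

(** Since f is bounded below by an affine function of the infeasibility theta,
f(x) = e - c (1 + theta) with e >= 0, and descent reads e' + psi' theta' <= e
+ psi' theta for psi = phi - c. For nondecreasing psi >= 1 the bound e + psi
theta <= psi L then propagates, and it implies theta <= L. *)
Lemma infeasibility_bounded : exists M, forall k, theta k <= M.
Proof.
have [K K0 hK] := aug_x_bound S0 Sb.
have [c1 c10 hc1] := qp_obj_ge H_psd.
pose c := c1 * K.
pose e k := qp_obj P (it_x (w k)) + c * (1 + theta k).
have e0 k : 0 <= e k.
  have h1 := hc1 (it_x (w k)); have h2 := ler_wpM2l c10 (hK _ _ _ (w_feasible k)).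
  by rewrite mulrA in h2; rewrite /e /c; lra.
have [N hN] := phi_large (c + 1).
apply: (@eventually_bounded _ _ N (e N + theta N)) => // k Nk.
suff Lk : e k + (phi k - c) * theta k <= (phi k - c) * (e N + theta N).
  have psi1 : 1 <= phi k - c by have := hN k Nk; lra.
  by have ek := e0 k; rewrite -(@ler_pM2l _ (phi k - c)); lra.
elim: k Nk => [|k IH].
  rewrite leqn0 => /eqP NE; have := hN 0%N; rewrite NE => /(_ isT) h.
  have := e0 0%N; nra.
rewrite leq_eqVlt => /orP[/eqP NE|].
  have := hN N (leqnn N); rewrite -NE => h; have := e0 N; nra.
rewrite ltnS => Nk; have {}IH := IH Nk.
have desc := master_descent w_master k.
have mono : phi k <= phi k.+1 by exact: phi_mono.
have psi1 : 1 <= phi k - c by have := hN k Nk; lra.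
have thetak : theta k <= e N + theta N.
  by have ek := e0 k; rewrite -(@ler_pM2l _ (phi k - c)); lra.
have {}desc : e k.+1 + (phi k.+1 - c) * theta k.+1 <=
    e k + (phi k.+1 - c) * theta k by rewrite /e; lra.
apply: le_trans desc _.
have : (phi k.+1 - phi k) * theta k <= (phi k.+1 - phi k) * (e N + theta N).
  by rewrite ler_wpM2l // subr_ge0.
lra.
Qed.

Lemma zy_bounded_unbounded : bounded_zy w.
Proof.
have [M hM] := infeasibility_bounded; apply: (@in_bounded _ _ _ _ _ M) => k _.
exact: le_trans (norm_zy_le (w_feasible k)) (hM k).
Qed.

End Unbounded.

(** [lagrangian_identity] at the iterate and at a fixed feasible point: with
x, z, y and the residuals bounded, all remainders are O(1), while the main
terms grow with the penalty. *)
Lemma certificate_estimate (K : set nat) xh zh yh :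
  aug_feasible P (xh, zh, yh) -> (forall k, 0 < phi k) ->
  (exists M, forall k, theta k <= M) ->
  [bounded G1 P (w k) | k in K] -> [bounded G2 P (phi k) (w k) | k in K] ->
  exists E, forall k, K k ->
  [/\ `|dual_comb P (w k)| <= E,
      phi k * theta k - E <= dual_value P (w k)
    & dual_value P (w k) <= phi k * infeasibility zh yh + E].
Proof.
move=> hf phi0 [M thetaM] /bounded_in[Gam1 hG1] /bounded_in[Gam2 hG2].
have [X X0 hX] := x_bounded thetaM.
have [L L0 hL] := mulmx_bounded (qpH P).
pose M1 := Num.max 0 M; pose D := L * X + `|qpc P| + `|Gam2|.
have M10 : 0 <= M1 by rewrite le_max lexx.
have D0 : 0 <= D by rewrite !addr_ge0 // mulr_ge0.
(* E1 bounds the remainders at the iterate, E2 those at the fixed point *)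
pose E1 := n%:R * (X * D) + m%:R * (M1 * `|Gam2|) + p%:R * (M1 * `|Gam2|)
  + (m + (m + (p + p)))%:R * `|Gam1|.
pose E2 := n%:R * (`|xh| * D) + m%:R * (`|zh| * `|Gam2|) + p%:R * (`|yh| * `|Gam2|).
have E10 : 0 <= E1.
  by rewrite /E1; do !apply: addr_ge0 => //; do ?apply: mulr_ge0 => //; apply: mulr_ge0.
have E20 : 0 <= E2.
  by rewrite /E2; do !apply: addr_ge0 => //; do ?apply: mulr_ge0 => //; apply: mulr_ge0.
exists (D + E1 + E2) => k Kk.
have {hG1} g1 : `|G1 P (w k)| <= `|Gam1| by rewrite (le_trans (hG1 _ Kk)) // ler_norm.
have {hG2} g2 : `|G2 P (phi k) (w k)| <= `|Gam2|.
  by rewrite (le_trans (hG2 _ Kk)) // ler_norm.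
have gx := le_trans (normv_col_mxl _ _) g2.
have {}g2 := le_trans (normv_col_mxr _ _) g2.
have gz := le_trans (normv_col_mxl _ _) g2.
have gy := le_trans (normv_col_mxr _ _) g2.
have {g2} zy : `|col_mx (it_z (w k)) (it_y (w k))| <= M1.
  by rewrite (le_trans (norm_zy_le (w_feasible k))) // le_max thetaM orbT.
have hz := le_trans (normv_col_mxl _ _) zy.
have {zy} hy := le_trans (normv_col_mxr _ _) zy.
have dD : `|dual_comb P (w k)| <= D.
  have -> : dual_comb P (w k) =
      qpH P *m it_x (w k) + qpc P - dual_resid P (w k).
    by rewrite /dual_comb /dual_resid; apply/colP=> i; rewrite !mxE; ring.
  rewrite (le_trans (ler_normB _ _)) // lerD // (le_trans (ler_normD _ _)) //.
  by rewrite lerD2r (le_trans (hL _)) // ler_wpM2l.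
have dot_le l (u v : 'cV[R]_l) a a' : `|u| <= a -> `|v| <= a' ->
    - (l%:R * (a * a')) <= dotv u v <= l%:R * (a * a').
  move=> ua va; rewrite -ler_norml (le_trans (normr_dotv_le _ _)) //.
  by rewrite ler_wpM2l // ler_pM.
split.
- by rewrite (le_trans dD) // -addrA lerDl addr_ge0.
- rewrite (lagrangian_identity P (phi k)).
  have /andP[a1 _] := dot_le _ _ _ _ _ (hX k) dD.
  have /andP[a2 _] := dot_le _ _ _ _ _ hz gz.
  have /andP[a3 _] := dot_le _ _ _ _ _ hy gy.
  have ones1 : `|ones R (m + (m + (p + p)))| <= 1.
    by apply/normv_leP => // i; rewrite mxE normr1.
  have /andP[_] := dot_le _ _ _ _ _ ones1 g1; rewrite mul1r => a4.
  move: E20 D0; rewrite /E1; lra.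
- pose wh := Iterate xh zh yh (it_pi (w k)) (it_xi (w k)) (it_eta (w k)) (it_zeta (w k)).
  have -> : dual_value P (w k) = dual_value P wh by [].
  have compl : 0 <= dotv (ones R _) (G1 P wh).
    by apply: complementarity_ge0 => //; exact: (w_dual_ge0 k).
  rewrite (lagrangian_identity P (phi k)) /=.
  have /andP[_ a1] := dot_le _ _ _ _ _ (lexx `|xh|) dD.
  have /andP[_ a2] := dot_le _ _ _ _ _ (lexx `|zh|) gz.
  have /andP[_ a3] := dot_le _ _ _ _ _ (lexx `|yh|) gy.
  have -> : dual_comb P wh = dual_comb P (w k) by [].
  move: E10 D0; rewrite /E2; lra.
Qed.

End Penalty.

(** * The certificate of infeasibility *)

Theorem theorem5p4 (R : realType) (n m p : nat)
    (hpn : (p <= n)%N) (hmp : (0 < m + p)%N)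
    (norm : forall k : nat, 'cV[R]_k -> R)
    (hnorm : forall k : nat, is_norm (norm k))
    (P : qp R n m p) (hH : sym_psd (qpH P))
    (b' : 'cV[R]_m) (dminus dplus : 'cV[R]_p)
    (hstanding : standing_assumptions P b' dminus dplus)
    (B : base_iteration R) (hB : is_base_iteration norm B)
    (upd : R -> iterate R n m p -> R)
    (w : nat -> iterate R n m p) (phi : nat -> R)
    (hgen : master_generated P B upd w phi)
    (hPU1 : PU1 phi) (hPU2 : PU2 w phi)
    (hPU3 : PU3 P norm w phi) (hPU4 : PU4 P norm w phi)
    (hinfeas : qp_feasible P = set0) :
  let alpha k := (phi k)^-1 in
  let pibar k := alpha k *: it_pi (w k) in
  let omegabar k := alpha k *: (it_eta (w k) - it_zeta (w k)) in
  P0_solutions P !=set0 /\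
  forall eps : R, 0 < eps -> exists khat : nat,
    [/\ norm n ((qpA P)^T *m pibar khat + (qpC P)^T *m omegabar khat) <= eps,
        0 < dotv (qpb P) (pibar khat) + dotv (qpd P) (omegabar khat),
        forall xhat zhat yhat, P0_solutions P (xhat, zhat, yhat) ->
          infeasibility (it_z (w khat)) (it_y (w khat)) <=
          infeasibility zhat yhat + eps
      & vle 0 (pibar khat)].
Proof.
move=> alpha pibar omegabar.
have [_ S0 _ Sb _] := hstanding.
have sol := P0_solution_exists S0 Sb; split=> // eps eps0.
have [[[xh zh] yh] [hf hmin]] := sol; rewrite /= in hmin.
have mu0 := infeasibility_gt0 hinfeas hf; set mu := infeasibility zh yh in hmin mu0.
have phi_pinfty := penalty_unbounded hH S0 Sb hnorm hB hgen hinfeas hPU1 hPU2 hPU3.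
have [phi0 phi_mono _] := hPU1.
have thetab := infeasibility_bounded hH S0 Sb hB hgen phi_mono phi_pinfty.
have zyb := zy_bounded_unbounded hH S0 Sb hB hgen phi_mono phi_pinfty.
have [K [Kinf G1b G2b _ _]] := hPU4 phi_pinfty zyb.
have [E hE] := certificate_estimate hH S0 Sb hB hgen hf phi0 thetab G1b G2b.
have [L [_ [L0 _ hL _]]] := is_norm_equiv (hnorm n).
pose E' := `|E| + 1; have E'0 : 0 < E' by rewrite ltr_wpDl.
have EE' : E < E' by rewrite /E' (le_lt_trans (ler_norm _)) // ltrDl.
(* one threshold on the penalty for each of the three conclusions *)
pose c := Num.max (L * E' / eps) (Num.max (E' / mu) (2 * E' / eps)).
have [N _ hN] := (cvgryPge _).1 phi_pinfty c.
have [k Kk /hN {hN}] := infinite_cofinal N Kinf.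
rewrite /= /c !ge_max !ler_pdivrMr // => /and3P[c1 c2 c3].
have [comb lower upper] := hE k Kk; rewrite -/mu in upper.
have feas := master_feasible hH hB hgen k.
have muk : mu <= infeasibility (it_z (w k)) (it_y (w k)).
  exact: (hmin (it_x (w k), it_z (w k), it_y (w k)) feas).
have pk := phi0 k.
have ge_mu : phi k * mu <= phi k * infeasibility (it_z (w k)) (it_y (w k)).
  by rewrite ler_pM2l.
exists k; split.
- have -> : (qpA P)^T *m pibar k + (qpC P)^T *m omegabar k =
      (phi k)^-1 *: dual_comb P (w k).
    by rewrite /pibar /omegabar -!scalemxAr -scalerDr.
  rewrite (norm_scale (hnorm n)) ger0_norm ?invr_ge0 ?(ltW pk) // ler_pdivrMl //.
  rewrite (le_trans (hL _)) // (le_trans _ c1) // ler_wpM2l //.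
  exact: le_trans comb (ltW EE').
- rewrite /pibar /omegabar !dotvZr -mulrDr mulr_gt0 ?invr_gt0 //.
  rewrite -/(dual_value P (w k)); lra.
- move=> x' z' y' [/= f' min'].
  have : mu <= infeasibility z' y' by exact: (hmin (x', z', y') f').
  suff : infeasibility (it_z (w k)) (it_y (w k)) <= mu + eps by lra.
  by rewrite -(ler_pM2l pk) mulrDr; lra.
- move=> i; have [pi0 _ _ _] := dual_ge0P (master_dual_ge0 hH hB hgen k).
  rewrite [leLHS]mxE /pibar [leRHS]mxE mulr_ge0 ?invr_ge0 ?(ltW pk) //.
  by have := pi0 i; rewrite mxE.
Qed.
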